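(* Let $G$ be a connected unicyclic graph. Then $\Gamma_{pr}(G)=2\Gamma(G)$ if and only if $G\in\{C_3, C_5, K_{1,t}^{*1}\}$ (for some $t$).
   Context: All graphs are finite, simple and undirected. A graph is unicyclic if it is connected and contains exactly one cycle. A set $D\subseteq V(G)$ is dominating if every vertex is in $D$ or adjacent to a vertex of $D$; it is minimal if no proper subset is dominating. $\Gamma(G)$ is the maximum cardinality of a minimal dominating set of $G$. A paired dominating set (PDS) is a dominating set $D$ such that $G[D]$ has a perfect matching; a PDS is minimal if no proper subset is a PDS. $\Gamma_{pr}(G)$ is the maximum cardinality of a minimal PDS. The subdivided star $K_{1,t}^*$ is obtained from the star $K_{1,t}$ by subdividing every edge once; $K_{1,t}^{*1}$ is the graph obtained from $K_{1,t}^*$ by attaching one triangle to its central vertex (i.e., adding two new adjacent vertices both adjacent to the central vertex). *)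

(* Defs.v *)
From mathcomp Require Import all_boot.

Set Implicit Arguments.
Unset Strict Implicit.
Unset Printing Implicit Defensive.

Record sgraph := SGraph {
  vertex :> finType;
  adj : rel vertex;
  adj_sym : symmetric adj;
  adj_irrefl : irreflexive adj
}.

Definition isomorphic (G H : sgraph) : Prop :=
  exists2 f : G -> H, bijective f & {mono f : x y / adj x y}.

Definition edges (G : sgraph) : {set {set G}} :=
  [set [set p.1; p.2] | p : G * G & adj p.1 p.2].

Definition connected (G : sgraph) : Prop :=
  forall x y : G, connect (@adj G) x y.

(* A cycle, as a subgraph, is identified with its set of edges, so that the
   rotations and the reversal of a cyclic sequence give the same cycle. *)
Definition cycle_edges (G : sgraph) (c : seq G) : {set {set G}} :=
  [set [set x; next c x] | x in c].

Definition is_cycle (G : sgraph) (C : {set {set G}}) : Prop :=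
  exists c : seq G,
    [/\ ucycle (@adj G) c, 2 < size c & C = cycle_edges c].

Definition unicyclic (G : sgraph) : Prop :=
  connected G /\ exists! C : {set {set G}}, is_cycle C.

Definition dominating (G : sgraph) (D : {set G}) : bool :=
  [forall x, (x \in D) || [exists y in D, adj x y]].

Definition induced_edges (G : sgraph) (D : {set G}) : {set {set G}} :=
  [set E in edges G | E \subset D].

Definition induced_perfect_matching (G : sgraph) (D : {set G})
    (M : {set {set G}}) : bool :=
  (M \subset induced_edges D) && partition M D.

Definition paired_dominating (G : sgraph) (D : {set G}) : bool :=
  dominating D && [exists M, induced_perfect_matching D M].

Definition Gamma (G : sgraph) : nat :=
  \max_(D : {set G} | minset (@dominating G) D) #|D|.

Definition Gamma_pr (G : sgraph) : nat :=
  \max_(D : {set G} | minset (@paired_dominating G) D) #|D|.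

Section CycleGraph.
Variable n : nat.

(* The conjunct i != j only matters for n = 1, where it removes the loop. *)
Definition cycle_adj : rel 'I_n :=
  [rel i j | (i != j) && ((j == ordS i) || (i == ordS j))].

Lemma cycle_adj_sym : symmetric cycle_adj.
Proof. by move=> i j; rewrite /cycle_adj /= eq_sym orbC. Qed.

Lemma cycle_adj_irrefl : irreflexive cycle_adj.
Proof. by move=> i; rewrite /cycle_adj /= eqxx. Qed.

Definition cycle_graph : sgraph := SGraph cycle_adj_sym cycle_adj_irrefl.

End CycleGraph.

Section Star.
Variable t : nat.

(* K_{1,t}: the centre is None, the leaves are the Some i. *)
Definition star_adj : rel (option 'I_t) := [rel x y | isSome x != isSome y].

Lemma star_adj_sym : symmetric star_adj.
Proof. by move=> x y; rewrite /star_adj /= eq_sym. Qed.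

Lemma star_adj_irrefl : irreflexive star_adj.
Proof. by move=> x; rewrite /star_adj /= eqxx. Qed.

Definition star : sgraph := SGraph star_adj_sym star_adj_irrefl.

End Star.

Section Subdivision.
Variable G : sgraph.

(* The subdivision vertex of an edge is that edge itself. *)
Definition subdivision_adj : rel (G + {E : {set G} | E \in edges G}) :=
  fun u v => match u, v with
  | inl x, inr E => x \in val E
  | inr E, inl x => x \in val E
  | _, _ => false
  end.

Lemma subdivision_adj_sym : symmetric subdivision_adj.
Proof. by case=> ? [] ?. Qed.

Lemma subdivision_adj_irrefl : irreflexive subdivision_adj.
Proof. by case. Qed.

Definition subdivision : sgraph :=
  SGraph subdivision_adj_sym subdivision_adj_irrefl.

End Subdivision.

Section AttachTriangle.
Variables (G : sgraph) (v : G).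

Definition attach_triangle_adj : rel (G + bool) :=
  fun a b => match a, b with
  | inl x, inl y => adj x y
  | inl x, inr _ => x == v
  | inr _, inl y => y == v
  | inr i, inr j => i != j
  end.

Lemma attach_triangle_adj_sym : symmetric attach_triangle_adj.
Proof. by case=> x [] y //=; [exact: adj_sym | rewrite eq_sym]. Qed.

Lemma attach_triangle_adj_irrefl : irreflexive attach_triangle_adj.
Proof. by case=> x /=; [exact: adj_irrefl | rewrite eqxx]. Qed.

Definition attach_triangle : sgraph :=
  SGraph attach_triangle_adj_sym attach_triangle_adj_irrefl.

End AttachTriangle.

Definition subdivided_star (t : nat) : sgraph := subdivision (star t).

Definition subdivided_star_center (t : nat) : subdivided_star t :=
  inl (None : star t).

Definition subdivided_star_triangle (t : nat) : sgraph :=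
  attach_triangle (subdivided_star_center t).

(* Main.v *)
Require Import Defs.
From mathcomp Require Import all_boot.

Set Implicit Arguments.
Unset Strict Implicit.
Unset Printing Implicit Defensive.

(** Let [D] be a minimal paired dominating set, paired by [m]. Each pair has a
    private neighbour, so a minimal dominating subset of [D] meets every pair and
    [Gamma_pr G <= 2 * Gamma G]. Deleting a vertex of the cycle leaves a forest,
    which has an independent set containing half of its vertices; hence
    [#|G| <= 2 * Gamma G + 1], and equality forces [D] to miss at most one vertex
    [c]. By minimality, an edge [s s'] of [D] outside the pairing makes
    [D \ {m s, m s'}], paired through [s s'], non-dominating, so all neighbours of
    [c] lie in [{m s, m s'}]. If there is no such edge, [G] consists of the pairs
    attached to [c], which is a [K_{1,t}^{*1}]; if there is one and [c] has two
    neighbours, [G] is a pentagon; if [c] is a leaf, the cycle would be a triangle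
    containing a pair without private neighbour. *)

(** * Perfect matchings as pairings, and minimal dominating sets *)

Section Domination.
Variable G : sgraph.
Implicit Types (x y z : G) (D A I : {set G}) (c p : seq G) (m : G -> G).

(** A perfect matching of [G[D]] is handled through its partner map, which is easier to restrict and
    to modify than a partition into edges; values outside [D] are arbitrary. *)
Definition pairing D m : Prop :=
  {in D, forall x, [/\ m x \in D, adj x (m x) & m (m x) = x]}.

Lemma adj_neq x y : adj x y -> x != y.
Proof. by apply: contraTneq => ->; rewrite adj_irrefl. Qed.

Lemma mem_edges x y : adj x y -> [set x; y] \in edges G.
Proof. by move=> axy; apply/imsetP; exists (x, y); rewrite ?inE. Qed.

Lemma edge_other_end E x :
  E \in edges G -> x \in E -> exists2 y, adj x y & E = [set x; y].
Proof.
case/imsetP=> -[u v]; rewrite inE /= => auv ->; rewrite !inE.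
case/orP=> /eqP->; first by exists v.
by exists u; [rewrite adj_sym | rewrite setUC].
Qed.

Lemma perfect_matching_pairing D M :
  induced_perfect_matching D M -> exists m, pairing D m.
Proof.
case/andP=> sM pM; have [/eqP cM tM _] := and3P pM.
(* The partner of [x] is the other element of its block. Blocks are edges, so the default [x] is
   never returned on [D]. *)
pose m x := odflt x [pick y in pblock M x | y != x].
have blk x : x \in D -> exists y, [/\ y \in D, adj x y & pblock M x = [set x; y]].
  rewrite -cM => xM; have bM := pblock_mem xM.
  have /setIdP[eE sE] := subsetP sM _ bM.
  have [||y axy eb] := @edge_other_end (pblock M x) x => //.
    by rewrite mem_pblock.
  exists y; split=> //; rewrite cM; apply: (subsetP sE).
  by rewrite eb !inE eqxx orbT.
have mE x y : adj x y -> pblock M x = [set x; y] -> m x = y.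
  move=> axy eb; rewrite /m; case: pickP => [z|/(_ y)] /=; rewrite eb !inE.
    by case/andP=> /orP[]/eqP-> //; rewrite eqxx.
  by rewrite eqxx orbT eq_sym (adj_neq axy).
exists m => x xD; have [y [yD axy eb]] := blk x xD.
rewrite (mE x y) //; split=> //; apply: mE; first by rewrite adj_sym.
rewrite setUC -eb; apply: same_pblock => //.
by rewrite eb !inE eqxx orbT.
Qed.

Lemma pairing_perfect_matching D m :
  pairing D m ->
  induced_perfect_matching D [set [set x; m x] | x in D].
Proof.
move=> mD; apply/andP; split.
  apply/subsetP=> _ /imsetP[x xD ->]; have [mxD axm _] := mD x xD; rewrite inE mem_edges //=.
  by rewrite subUset !sub1set mxD xD.
apply/and3P; split.
- apply/eqP/setP=> x; apply/bigcupP/idP.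
    by case=> _ /imsetP[y yD ->]; rewrite !inE => /orP[]/eqP-> //; case: (mD y yD).
  by move=> xD; exists [set x; m x]; [apply: imset_f | rewrite !inE eqxx].
- apply/trivIsetP=> _ _ /imsetP[x xD ->] /imsetP[y yD ->].
  apply: contraR => /pred0Pn[z /andP[/= zx zy]].
  have same u : u \in D -> z \in [set u; m u] -> [set u; m u] = [set z; m z].
    move=> uD; rewrite !inE => /orP[]/eqP-> //.
    by case: (mD u uD) => _ _ ->; rewrite setUC.
  by rewrite (same x) // (same y).
- by apply/imsetP=> -[x _ /setP/(_ x)]; rewrite !inE eqxx.
Qed.

Lemma paired_dominatingP D :
  reflect (dominating D /\ exists m, pairing D m) (paired_dominating D).
Proof.
apply: (iffP andP) => -[domD H]; split=> //.
  by have [M /perfect_matching_pairing] := existsP H.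
by have [m /pairing_perfect_matching pM] := H; apply/existsP; eexists; exact: pM.
Qed.

Lemma dominatingP D :
  reflect (forall x, x \in D \/ exists2 y, y \in D & adj x y) (dominating D).
Proof.
apply: (iffP forallP) => H x.
  by case/orP: (H x); [left | case/exists_inP; right; exists x0].
by apply/orP; case: (H x) => [|[y yD axy]]; [left | right; apply/exists_inP; exists y].
Qed.

Lemma not_dominating D :
  ~~ dominating D -> exists2 w, w \notin D & {in D, forall z, ~~ adj w z}.
Proof.
rewrite negb_forall => /existsP[w]; rewrite negb_or => /andP[wD].
by rewrite negb_exists_in => /forall_inP; exists w.
Qed.

Lemma leq_Gamma D : minset (@dominating G) D -> #|D| <= Gamma G.
Proof. exact: (@leq_bigmax_cond _ _ (fun D : {set G} => #|D|)). Qed.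

Lemma leq_Gamma_pr D : minset (@paired_dominating G) D -> #|D| <= Gamma_pr G.
Proof. exact: (@leq_bigmax_cond _ _ (fun D : {set G} => #|D|)). Qed.

Lemma Gamma_pr_attained :
  0 < Gamma_pr G ->
  exists2 D, minset (@paired_dominating G) D & #|D| = Gamma_pr G.
Proof.
move=> pos.
case: (pickP (fun D => minset (@paired_dominating G) D)) => [D0 D0min|none].
  have [|D DM E] := @eq_bigmax_cond _ [pred D | minset (@paired_dominating G) D]
    (fun D : {set G} => #|D|).
    by apply/card_gt0P; exists D0.
  by exists D => //; rewrite -E.
by move: pos; rewrite /Gamma_pr big_pred0.
Qed.

(** Otherwise [y] would dominate everything that [x] dominates, and [D :\ x] would still be
    dominating. *)
Lemma minset_domination_subset D x y :
  minset (@dominating G) D -> x \in D -> y \in D -> x != y ->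
  ~ (forall z, z = x \/ adj x z -> z = y \/ adj y z).
Proof.
case/minsetP=> domD minD xD yD xy sub.
suff dx : dominating (D :\ x).
  by have := minD _ dx (subsetDl _ _); move/setP/(_ x); rewrite !inE eqxx xD.
have yDx : y \in D :\ x by rewrite !inE eq_sym xy.
apply/dominatingP=> z.
have viay : z = x \/ adj x z -> z \in D :\ x \/ exists2 y, y \in D :\ x & adj z y.
  by case/sub=> [->|ayz]; [left | right; exists y; rewrite // adj_sym].
have [zx|zx] := eqVneq z x; first by apply: viay; left.
case: (dominatingP _ domD z) => [zD|[u uD azu]]; first by left; rewrite !inE zx.
have [ux|ux] := eqVneq u x; first by apply: viay; right; rewrite -ux adj_sym.
by right; exists u; rewrite // !inE ux.
Qed.

Definition independent I := [forall x in I, forall y in I, ~~ adj x y].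

Lemma independentP I :
  reflect {in I &, forall x y, ~~ adj x y} (independent I).
Proof.
apply: (iffP forall_inP) => H x.
  by move=> y xI yI; exact: (forall_inP (H x xI)).
by move=> xI; apply/forall_inP=> y yI; exact: H.
Qed.

(** A maximal independent set [J] containing [I] is a minimal dominating set: a vertex without
    neighbour in [J] could be added to it, and a member of [J] is dominated from within [J] only by
    itself. *)
Lemma independent_leq_Gamma I : independent I -> #|I| <= Gamma G.
Proof.
move=> indI; have [J /maxsetP[/independentP indJ maxJ] sIJ] := maxset_exists indI.
apply: leq_trans (subset_leq_card sIJ) (leq_Gamma _); apply/minsetP; split.
  apply/dominatingP=> x; have [xJ|xJ] := boolP (x \in J); first by left.
  right; apply/exists_inP; apply: contraR xJ; rewrite negb_exists_in.
  move/forall_inP=> nadj; rewrite -(maxJ (x |: J)) ?subsetUr ?setU11 //.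
  apply/independentP=> u v; rewrite !inE.
  case/predU1P=> [->|uJ] /predU1P[->|vJ].
  - by rewrite adj_irrefl.
  - exact: nadj.
  - by rewrite adj_sym nadj.
  - exact: indJ.
move=> K domK sKJ; apply/eqP; rewrite eqEsubset sKJ; apply/subsetP=> x xJ.
case: (dominatingP _ domK x) => // -[y /(subsetP sKJ) yJ].
by rewrite (negbTE (indJ _ _ xJ yJ)).
Qed.

(** * Private neighbours and exchange of pairs *)

Section MinimalPaired.
Variables (D : {set G}) (m : G -> G).
Hypotheses (Dmin : minset (@paired_dominating G) D) (mD : pairing D m).

Lemma pairing_neq x : x \in D -> m x != x.
Proof. by move=> xD; rewrite eq_sym; apply: adj_neq; case: (mD xD). Qed.

Lemma minimal_paired_undominated D' m' :
  D' \proper D -> pairing D' m' ->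
  exists2 w, w \notin D' & {in D', forall z, ~~ adj w z}.
Proof.
move=> pD' mD'; apply: not_dominating; apply/negP=> domD'.
have [_ minD] := minsetP Dmin.
move: (pD'); rewrite properE => /andP[sD' /negP]; apply.
rewrite (minD D') //; apply/paired_dominatingP; split=> //.
by exists m'.
Qed.

(** Without the pair of [x] the set is still paired, so by minimality some [w] becomes undominated;
    the closed neighbourhood of [w] meets [D] only inside that pair. *)
Lemma minimal_paired_private x : x \in D ->
  exists w, {in D, forall z, z = w \/ adj w z -> z = x \/ z = m x}.
Proof.
move=> xD; have [mxD _ mmx] := mD xD.
have pr : D :\: [set x; m x] \proper D.
  apply/properP; split; first exact: subsetDl.
  by exists x; rewrite // !inE eqxx.
have [|w wD nw] := @minimal_paired_undominated _ m pr.
  move=> z; rewrite !inE negb_or => /andP[/andP[zx zmx] zD].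
  have [mzD az mmz] := mD zD; split=> //; rewrite mzD andbT negb_or.
  apply/andP; split; last by apply: contraNneq zx => e; rewrite -mmz e mmx.
  by apply: contraNneq zmx => e; rewrite -mmz e.
exists w => z zD wz; have [->|zx] := eqVneq z x; first by left.
have [->|zmx] := eqVneq z (m x); first by right.
have zD' : z \in D :\: [set x; m x] by rewrite !inE negb_or zx zmx.
by case: wz => [ezw|]; [rewrite -ezw zD' in wD | rewrite (negbTE (nw z zD'))].
Qed.

(* Replacing the pairs {s, m s} and {s', m s'} by {s, s'} leaves a smaller
   paired set, so it must fail to dominate some vertex. *)
Lemma minimal_paired_swap s s' : s \in D -> s' \in D -> adj s s' -> s' != m s ->
  exists2 w, w \notin D & {in D, forall z, adj w z -> z = m s \/ z = m s'}.
Proof.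
move=> sD s'D ass s'ms; have [msD ams mms] := mD sD.
have [ms'D ams' mms'] := mD s'D; have ss := adj_neq ass.
have sms' : s != m s' by apply: contraNneq s'ms => ->; rewrite mms'.
pose D' := D :\: [set m s; m s'].
have memD' z : (z \in D') = [&& z != m s, z != m s' & z \in D].
  by rewrite !inE negb_or andbA.
have pr : D' \proper D.
  apply/properP; split; first exact: subsetDl.
  by exists (m s); rewrite // memD' eqxx.
have sD' : s \in D' by rewrite memD' sD sms' eq_sym pairing_neq.
have s'D' : s' \in D' by rewrite memD' s'D s'ms eq_sym pairing_neq.
pose m' z := if z == s then s' else if z == s' then s else m z.
have [|w wD nw] := @minimal_paired_undominated _ m' pr.
  move=> z zD'; rewrite /m'; have [->|zs] := eqVneq z s.
    by rewrite eqxx [s' == s]eq_sym (negbTE ss).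
  have [->|zs'] := eqVneq z s'; first by rewrite eqxx adj_sym.
  move: (zD'); rewrite memD' => /and3P[zms zms' zD].
  have [mzD amz mmz] := mD zD.
  have -> : (m z == s) = false by apply: contraNF zms => /eqP<-; rewrite mmz.
  have -> : (m z == s') = false by apply: contraNF zms' => /eqP<-; rewrite mmz.
  rewrite memD' mzD andbT; split=> //; apply/andP; split.
    by apply: contraNneq zs => e; rewrite -mmz e mms.
  by apply: contraNneq zs' => e; rewrite -mmz e mms'.
exists w.
  (* A vertex of [D] outside [D'] is [m s] or [m s'], which [s] or [s'] still dominates. *)
  apply/negP=> wDD; move: wD; rewrite memD' wDD andbT negb_and !negbK.
  case/orP=> /eqP ew.
    by move: (nw s sD'); rewrite ew adj_sym ams.
  by move: (nw s' s'D'); rewrite ew adj_sym ams'.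
move=> z zD awz; have [->|zx] := eqVneq z (m s); first by left.
have [->|zmx] := eqVneq z (m s'); first by right.
have zD' : z \in D' by rewrite memD' zx zmx.
by rewrite (negbTE (nw z zD')) in awz.
Qed.

End MinimalPaired.

Lemma Gamma_pr_leq : Gamma_pr G <= 2 * Gamma G.
Proof.
apply/bigmax_leqP=> D Dmin; have [pD _] := minsetP Dmin.
have [domD [m mD]] := paired_dominatingP _ pD.
have [D' D'min sD'] := minset_exists domD.
have [domD' _] := minsetP D'min.
have cov : D \subset D' :|: m @: D'.
  apply/subsetP=> x xD; have [w pw] := minimal_paired_private Dmin mD xD.
  have [_ _ mmx] := mD _ xD.
  (* The vertex of [D'] that dominates [w] lies in [D], hence in the pair whose private neighbour is
     [w]. *)
  have: exists2 z, z \in D' & z = x \/ z = m x.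
    case: (dominatingP _ domD' w) => [wD'|[z zD' awz]].
      by exists w => //; apply: pw; [exact: (subsetP sD') | left].
    by exists z => //; apply: pw; [exact: (subsetP sD') | right].
  case=> z zD' [ez|ez]; rewrite inE -?ez ?zD' //.
  by rewrite -mmx -ez imset_f ?orbT.
apply: leq_trans (subset_leq_card cov) _; rewrite cardsU mul2n -addnn.
apply: leq_trans (leq_subr _ _) _.
by apply: leq_add; rewrite ?(leq_trans (leq_imset_card _ _)) // leq_Gamma.
Qed.

(** * Cycles, forests and the order of a unicyclic graph *)

Lemma long_path_or_cycle A n :
  A != set0 ->
  {in A, forall x, exists y z, [/\ y \in A, z \in A, y != z, adj x y & adj x z]} ->
  (exists c, [/\ ucycle (@adj G) c, 2 < size c & {subset c <= A}]) \/
  (exists x p, [/\ path (@adj G) x p, uniq (x :: p), {subset x :: p <= A}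
                 & size p = n]).
Proof.
move=> /set0Pn[x0 x0A] deg2; elim: n => [|n IHn].
  right; exists x0, [::]; split=> // x; rewrite inE => /eqP->; exact: x0A.
case: IHn => [|[x [p [pth un sub sz]]]]; first by left.
(* The path is extended backwards from [x] without returning to its second vertex: a new vertex
   lengthens it, an old one closes a cycle of length at least 3. For empty [p] the default of [head]
   is [x], which excludes no neighbour. *)
have [y [yA axy yh]] : exists y, [/\ y \in A, adj x y & y != head x p].
  have [|y [z [yA zA yz axy axz]]] := deg2 x; first by rewrite sub ?mem_head.
  have [e|ne] := eqVneq y (head x p); last by exists y.
  by exists z; rewrite -e eq_sym.
have [yp|yp] := boolP (y \in x :: p); last first.
  right; exists y, (x :: p); split; rewrite /= ?sz //.
  - by rewrite adj_sym axy.
  - by rewrite yp.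
  by move=> z; rewrite inE => /predU1P[->|/sub].
left; move: yp; rewrite inE eq_sym (negbTE (adj_neq axy)) /= => yp.
case/splitPr: yp pth un sub yh {sz} => p1 p2.
rewrite cat_path /= => /and3P[pth1 al _] un sub yh.
exists (x :: rcons p1 y); split.
- rewrite /ucycle /= rcons_path rcons_path pth1 al last_rcons adj_sym axy /=.
  move: un; rewrite /= -cat_rcons mem_cat cat_uniq negb_or.
  by case/andP=> /andP[-> _] /andP[-> _].
- by case: p1 {pth1 al un sub} yh => [|u p1] /=; rewrite ?eqxx // size_rcons.
- move=> z zc; apply: sub; rewrite -cat_rcons -cat_cons mem_cat.
  by rewrite zc.
Qed.

Lemma min_degree2_cycle A :
  A != set0 ->
  {in A, forall x, exists y z, [/\ y \in A, z \in A, y != z, adj x y & adj x z]} ->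
  exists c, [/\ ucycle (@adj G) c, 2 < size c & {subset c <= A}].
Proof.
move=> A0 deg2.
(* A path with [#|G|] edges would have [#|G|.+1] distinct vertices. *)
case: (long_path_or_cycle #|G| A0 deg2) => // -[x [p [_ un _ sz]]].
by have := max_card (mem (x :: p)); rewrite (card_uniqP un) /= sz ltnn.
Qed.

(** Induction on [#|A|]: acyclicity yields a vertex [v] with at most one neighbour in [A]. Selecting
    [v] and discarding it together with that neighbour uses at most two vertices of [A] for one of
    [I]. *)
Lemma acyclic_independent A :
  (forall c, ucycle (@adj G) c -> 2 < size c -> ~ {subset c <= A}) ->
  exists I, [/\ independent I, I \subset A & #|A| <= 2 * #|I|].
Proof.
have [n] := ubnP #|A|; elim: n A => // n IHn A ltAn acyc.
have [->|A0] := eqVneq A set0.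
  exists set0; rewrite sub0set cards0; split=> //.
  by apply/independentP=> x y; rewrite inE.
have [v [vA v1]] : exists v, v \in A /\
    {in A &, forall y z, adj v y -> adj v z -> y = z}.
  case: (pickP (fun v => (v \in A) && [forall y in A, forall z in A,
    adj v y ==> adj v z ==> (y == z)])) => [v /andP[vA /forall_inP H]|none].
    exists v; split=> // y z yA zA avy avz.
    by have /implyP/(_ avy)/implyP/(_ avz)/eqP := forall_inP (H y yA) z zA.
  have [|c [uc sc sub]] := min_degree2_cycle A0; last by case: (acyc c).
  move=> x xA; have := none x; rewrite xA /= => /negbT.
  rewrite negb_forall_in => /exists_inP[y yA].
  rewrite negb_forall_in => /exists_inP[z zA].
  by rewrite !negb_imply => /and3P[axy axz yz]; exists y, z.
pose N := v |: [set y in A | adj v y].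
have vN : v \in N by rewrite !inE eqxx.
have cN : #|N| <= 2.
  rewrite cardsU1; apply: (@leq_add _ _ 1 1); first by case: (v \notin _).
  apply/card_le1_eqP => y z; rewrite !inE => /andP[yA avy] /andP[zA avz].
  exact: v1.
have sN : #|A :\: N| < #|A|.
  apply: proper_card; apply/properP; split; first exact: subsetDl.
  by exists v; rewrite // inE vN.
have [||I [/independentP indI sI cI]] := IHn (A :\: N).
- exact: leq_trans sN _.
- by move=> c uc sc sub; apply: (acyc c) => // x /sub /setDP[].
have vI : v \notin I by apply: contraL vN => /(subsetP sI) /setDP[].
have nvI y : y \in I -> ~~ adj v y.
  by move/(subsetP sI)/setDP=> [yA]; rewrite !inE yA negb_or => /andP[].
exists (v |: I); split.
- apply/independentP=> x y; rewrite !inE.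
  case/predU1P=> [->|xI] /predU1P[->|yI].
  + by rewrite adj_irrefl.
  + exact: nvI.
  + by rewrite adj_sym nvI.
  + exact: indI.
- by rewrite subUset sub1set vA (subset_trans sI) ?subsetDl.
rewrite cardsU1 vI mulnDr muln1 -(cardsID N A); apply: leq_add => //.
exact: leq_trans (subset_leq_card (subsetIr _ _)) cN.
Qed.

(** Once [c] is rotated to start at [x], the neighbours are its second and last entries, which
    differ because the length exceeds 2. *)
Lemma cycle_neighbours c x :
  ucycle (@adj G) c -> 2 < size c -> x \in c ->
  exists y z, [/\ y \in c, z \in c, y != z, adj x y & adj x z].
Proof.
move=> /andP[cc uc] sc xc; have [i p ep] := rot_to xc.
have mem z : (z \in c) = (z \in x :: p) by rewrite -ep mem_rot.
have {uc} : uniq (x :: p) by rewrite -ep rot_uniq.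
have {cc} : cycle (@adj G) (x :: p) by rewrite -ep rot_cycle.
have {sc} : 2 < size (x :: p) by rewrite -ep size_rot.
case: p ep mem => [|y [|z q]] // _ mem _ /=.
rewrite rcons_path => /and3P[axy _ /andP[_ ax]] /and3P[_ yq _].
exists y, (last z q); split; rewrite ?mem ?inE ?eqxx ?orbT //.
- by rewrite -in_cons mem_last !orbT.
- by apply: contraNneq yq => ->; rewrite mem_last.
- by rewrite adj_sym.
Qed.

Lemma mem_cover_cycle_edges c x : (x \in cover (cycle_edges c)) = (x \in c).
Proof.
apply/bigcupP/idP => [[_ /imsetP[y yc ->]]|xc].
  by rewrite !inE => /orP[]/eqP->; rewrite ?mem_next.
by exists [set x; next c x]; rewrite ?inE ?eqxx //; apply/imsetP; exists x.
Qed.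

(** Uniqueness of the edge set becomes uniqueness of the vertex set, since the latter is the cover
    of the former. *)
Lemma unicyclic_cycle : unicyclic G ->
  exists c, [/\ ucycle (@adj G) c, 2 < size c &
    forall c', ucycle (@adj G) c' -> 2 < size c' -> c' =i c].
Proof.
case=> _ [C [[c [uc sc ->]] uniqC]]; exists c; split=> // c' uc' sc' x.
rewrite -!mem_cover_cycle_edges (uniqC (cycle_edges c')) //.
by exists c'.
Qed.

Lemma unicyclic_card : unicyclic G -> #|G| <= (2 * Gamma G).+1.
Proof.
case/unicyclic_cycle=> -[|x c] [uc sc all_c] //.
(* Every cycle passes through [x], so the complement of [x] induces a forest. *)
have [|I [indI _ cI]] := @acyclic_independent [set~ x].
  move=> c' uc' sc' sub.
  have: x \in c' by rewrite (all_c c') // mem_head.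
  by move/sub; rewrite !inE eqxx.
rewrite -cardsT (cardsD1 x) inE ltnS setTD; apply: leq_trans cI _.
by rewrite leq_mul2l independent_leq_Gamma.
Qed.

End Domination.

(** * Spiders and their domination numbers *)

Lemma inj_surj_bij (T T' : finType) (f : T -> T') :
  injective f -> (forall y, exists x, f x = y) -> bijective f.
Proof.
move=> injf surjf; apply: inj_card_bij => //.
rewrite -(card_codom injf); apply: subset_leq_card; apply/subsetP=> y _.
by have [x <-] := surjf y; apply: codom_f.
Qed.

Lemma isomorphic_sym (G H : sgraph) : isomorphic G H -> isomorphic H G.
Proof.
case=> f [g fK gK] monof; exists g; first by exists f.
by move=> x y; rewrite -monof !gK.
Qed.

(* K_{1,t}^{*1} centred at [c] with triangle [c, a, m a]; for simplicity further
   pairs are also allowed to form a triangle with [c]. *)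
Record spider (G : sgraph) (c a : G) (m : G -> G) : Prop := Spider {
  spider_a : adj c a;
  spider_ma : adj c (m a);
  spider_off x : x != c -> m x != c;
  spider_inv x : x != c -> m (m x) = x;
  spider_adj x y : x != c -> y != c -> adj x y = (y == m x);
  spider_foot x : x != c -> adj c x || adj c (m x)
}.

Lemma spider_iso (G H : sgraph) c a m :
  isomorphic G H -> @spider H c a m -> exists c' a' m', @spider G c' a' m'.
Proof.
case=> f [g fK gK] monof sp.
have fc x : x != g c -> f x != c by apply: contraNneq => <-; rewrite fK.
exists (g c), (g a), (fun x => g (m (f x))).
split=> [|| x /fc|x /fc|x y /fc xc /fc yc|x /fc xc]; rewrite -?monof ?gK.
- exact: spider_a sp.
- exact: spider_ma sp.
- by move/(spider_off sp); apply: contraNneq => /(can_inj gK)->.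
- by move/(spider_inv sp)->.
- by rewrite (spider_adj sp) // -(inj_eq (can_inj gK)) fK.
- exact: spider_foot sp _ xc.
Qed.

Section SpiderDomination.
Variables (G : sgraph) (c a : G) (m : G -> G).
Hypothesis sp : spider c a m.

Let ca : a != c.
Proof. by rewrite eq_sym (adj_neq (spider_a sp)). Qed.

Lemma spider_pairing : pairing [set~ c] m.
Proof.
move=> x; rewrite !inE => xc; split; first exact: spider_off sp _ xc.
  by rewrite (spider_adj sp) // (spider_off sp).
exact: spider_inv sp _ xc.
Qed.

(** Away from [c] a pairing can only follow [m], so a paired dominating set inside the complement of
    [c] is a union of pairs; a vertex of an omitted pair would have nothing but [c] left to dominate
    it. *)
Lemma spider_minimal_paired : minset (@paired_dominating G) [set~ c].
Proof.
apply/minsetP; split.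
  apply/paired_dominatingP; split; last by exists m; exact: spider_pairing.
  apply/dominatingP=> x; rewrite !inE; have [->|] := eqVneq x c; last by left.
  by right; exists a; rewrite ?inE // (spider_a sp).
move=> D /paired_dominatingP[domD [p pD]] sD.
apply/eqP; rewrite eqEsubset sD; apply/subsetP=> x; rewrite !inE => xc.
have offc z : z \in D -> z != c by move/(subsetP sD); rewrite !inE.
have closedD z : z \in D -> m z \in D.
  move=> zD; have [pzD azp _] := pD z zD.
  by move: azp; rewrite (spider_adj sp) ?offc // => /eqP<-.
case: (dominatingP _ domD x) => // -[y yD].
rewrite (spider_adj sp xc (offc y yD)) => /eqP ey.
by rewrite -(spider_inv sp xc) -ey closedD.
Qed.

(** A minimal dominating set [D] is traded for a set [E] of the same size that avoids [c] and takes
    at most one vertex from each pair; [E] and [m @: E] are then disjoint subsets of the complement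
    of [c]. *)
Lemma spider_Gamma : 2 * Gamma G <= #|[set~ c]|.
Proof.
rewrite mul2n -geq_half_double; apply/bigmax_leqP=> D Dmin.
rewrite geq_half_double.
have offm x : x != c -> m x != c := @spider_off _ _ _ _ sp x.
have mK x : x != c -> m (m x) = x := @spider_inv _ _ _ _ sp x.
have nbr x z : x != c -> z = x \/ adj x z -> [\/ z = x, z = m x | z = c /\ adj c x].
  move=> xc [->|axz]; first by constructor 1.
  have [zc|zc] := eqVneq z c; first by constructor 3; rewrite -zc adj_sym.
  by constructor 2; apply/eqP; rewrite -(spider_adj sp).
(* The assumptions put the closed neighbourhood of [x] inside that of its partner [y]. *)
have foot x y : x != c -> x \in D -> y \in D -> y = m x ->
    (adj c x -> adj c y) -> False.
  move=> xc xD yD ey sub.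
  have axy : adj x y by rewrite (spider_adj sp) ?ey ?offm.
  apply: (@minset_domination_subset _ D x y) => //; first exact: adj_neq axy.
  move=> z /(nbr x z xc)[->|->|[-> cx]].
  - by right; rewrite adj_sym.
  - by left.
  - by right; rewrite adj_sym sub.
(* The closed neighbourhoods of two partners are always nested; the direction depends on whether [c]
   is adjacent to [m x]. *)
have half x : x != c -> x \in D -> m x \notin D.
  move=> xc xD; apply/negP=> mxD.
  have [|ncm] := boolP (adj c (m x)); first by move=> cm; apply: (foot x (m x)).
  by apply: (foot (m x) x); rewrite ?offm ?mK // (negbTE ncm).
(* The closed neighbourhood of a vertex of the triangle lies in that of [c]. *)
have noa x : x = a \/ x = m a -> c \in D -> x \notin D.
  move=> xa cD; apply/negP=> xD.
  have cx : adj c x by case: xa => ->; [exact: spider_a sp | exact: spider_ma sp].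
  have cmx : adj c (m x).
    by case: xa => ->; rewrite ?mK //; [exact: spider_ma sp | exact: spider_a sp].
  have xc : x != c by rewrite eq_sym adj_neq.
  apply: (@minset_domination_subset _ D x c) => // z /(nbr x z xc)[->|->|[-> _]].
  - by right.
  - by right.
  - by left.
(* When [c] is in [D], neither [a] nor [m a] is, so [a] can replace [c] without loss of size and
   without completing a pair. *)
pose E := if c \in D then a |: D :\ c else D.
have cE : #|E| = #|D|.
  rewrite /E; case: ifP => // cD; rewrite cardsU1 (cardsD1 c D) cD.
  by rewrite !inE (negbTE (noa a _ cD)) ?andbF //; left.
have offE x : x \in E -> x != c.
  rewrite /E; case: ifP => [_|cD]; last by apply: contraTneq => ->; rewrite cD.
  by rewrite !inE => /predU1P[->|/andP[]].
have halfE x : x \in E -> m x \notin E.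
  move=> xE; have xc := offE x xE; move: xE; rewrite /E; case: ifP => cD; last exact: half.
  rewrite !inE !negb_or negb_and negbK (negbTE (offm x xc)) /=.
  case/predU1P=> [->|/andP[_ xD]].
    by rewrite noa //; [rewrite eq_sym adj_neq // (spider_adj sp) ?offm | right].
  rewrite half // andbT; apply: contraTneq xD => e.
  by rewrite noa //; right; rewrite -e mK.
have cmE : #|m @: E| = #|E|.
  apply: card_in_imset => x y /offE xc /offE yc e.
  by rewrite -(mK x) // e mK.
rewrite -cE -addnn -{2}cmE -cardsUI.
have -> : E :&: m @: E = set0.
  apply/setP=> x; rewrite !inE; apply/negP=> /andP[xE /imsetP[y yE ex]].
  by move: (halfE y yE); rewrite -ex xE.
rewrite cards0 addn0; apply: subset_leq_card; apply/subsetP=> x; rewrite !inE.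
by case/orP=> [/offE //|/imsetP[y /offE yc ->]]; rewrite offm.
Qed.

Lemma spider_Gamma_pr : Gamma_pr G = 2 * Gamma G.
Proof.
apply/eqP; rewrite eqn_leq Gamma_pr_leq (leq_trans spider_Gamma) //.
exact: leq_Gamma_pr spider_minimal_paired.
Qed.

End SpiderDomination.

(** * The triangle and the subdivided stars as spiders *)

Lemma triangle_spider : exists c a m, @spider (cycle_graph 3) c a m.
Proof.
pose o k (H : k < 3) : cycle_graph 3 := Ordinal H.
pose m (x : cycle_graph 3) := if val x is 0 then x else
  if val x is 1 then o 2 isT else o 1 isT.
exists (o 0 isT), (o 1 isT), m.
(* Quantifiers over ['I_3] are expanded into explicit ordinals so that each clause becomes a closed
   computation. *)
have all3 (P : cycle_graph 3 -> Prop) :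
    P (o 0 isT) -> P (o 1 isT) -> P (o 2 isT) -> forall x, P x.
  move=> P0 P1 P2 [[|[|[|k]]] Hk] //.
  - by rewrite (_ : Ordinal Hk = o 0 isT) //; apply: val_inj.
  - by rewrite (_ : Ordinal Hk = o 1 isT) //; apply: val_inj.
  - by rewrite (_ : Ordinal Hk = o 2 isT) //; apply: val_inj.
by split=> //; refine (all3 _ _ _ _); try refine (all3 _ _ _ _); vm_compute.
Qed.

Section SpiderModel.
Variable t : nat.

Lemma star_edgeP (i : 'I_t) : [set None; Some i] \in edges (star t).
Proof. by apply: (@mem_edges (star t)). Qed.

(** Edges of the star correspond bijectively to its leaves, so subdivision vertices can be named by
    indices in ['I_t]. *)
Definition star_edge (i : 'I_t) : {E : {set star t} | E \in edges (star t)} :=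
  exist (fun E : {set star t} => E \in edges (star t)) _ (star_edgeP i).

Lemma star_edge_exists E : exists i, E == star_edge i.
Proof.
case: E => E Edg; have /imsetP[[u v]] := Edg; rewrite inE /= => auv eE.
suff [i ei] : exists i, E = [set None; Some i].
  by exists i; apply/eqP/val_inj.
case: u v auv eE => [i|] [j|] //= _ ->; last by exists j.
by exists i; rewrite setUC.
Qed.

Lemma mem_star_edge i (x : star t) :
  (x \in val (star_edge i)) = (x == None) || (x == Some i).
Proof. by rewrite !inE. Qed.

Definition star_edge_leaf (E : {E : {set star t} | E \in edges (star t)}) : 'I_t :=
  xchoose (star_edge_exists E).

Lemma star_edge_leafK : cancel star_edge_leaf star_edge.
Proof. by move=> E; rewrite -(eqP (xchooseP (star_edge_exists E))). Qed.

Lemma star_edgeK : cancel star_edge star_edge_leaf.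
Proof.
move=> i; have := mem_star_edge (star_edge_leaf (star_edge i)) (Some i).
by rewrite star_edge_leafK mem_star_edge eqxx orbT => /esym/eqP[].
Qed.

Lemma mem_star_edgeE (E : {E : {set star t} | E \in edges (star t)}) (x : star t) :
  (x \in val E) = (x == None) || (x == Some (star_edge_leaf E)).
Proof. by rewrite -{1}[E]star_edge_leafK mem_star_edge. Qed.

Let H := subdivided_star_triangle t.

Definition model_pairing (x : H) : H :=
  match x with
  | inl (inl (Some i)) => inl (inr (star_edge i))
  | inl (inr E) => inl (inl (Some (star_edge_leaf E)))
  | inr b => inr (~~ b)
  | _ => x
  end.

Lemma subdivided_star_triangle_spider :
  @spider H (inl (inl None)) (inr true) model_pairing.
Proof.
split=> //.
- by move=> [[[i|]|E]|b].
- by move=> [[[i|]|E]|b] //= _; rewrite ?star_edge_leafK ?star_edgeK ?negbK.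
- move=> [[[i|]|E]|b] [[[j|]|F]|d] // _ _.
  + rewrite /adj /= mem_star_edgeE /=; apply/eqP/eqP => [[->]|[->]].
      by rewrite star_edge_leafK.
    by rewrite star_edgeK.
  + rewrite /adj /= mem_star_edgeE /=; apply/eqP/eqP => [[->] //|[->] //].
  + by case: b; case: d.
- by move=> [[[i|]|E]|b] // _; rewrite /adj /= ?mem_star_edgeE ?inE.
Qed.

End SpiderModel.

(** Every pair other than that of [a] has exactly one vertex adjacent to [c]. These vertices form
    [S] and become the subdivision vertices, their partners become the leaves, and [t] is [#|S|]. *)
Lemma spider_isomorphic (G : sgraph) (c a : G) m :
  spider c a m ->
  (forall x, x != c -> adj c x -> adj c (m x) -> x = a \/ x = m a) ->
  exists t, isomorphic G (subdivided_star_triangle t).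
Proof.
move=> sp one; pose S := [set x | adj c x & (x != a) && (x != m a)].
have offm x : x != c -> m x != c := @spider_off _ _ _ _ sp x.
have mK x : x != c -> m (m x) = x := @spider_inv _ _ _ _ sp x.
have offS x : x \in S -> x != c.
  by rewrite inE => /andP[/adj_neq]; rewrite eq_sym.
have ac : a != c by rewrite eq_sym (adj_neq (spider_a sp)).
have mSc x : x \in S -> ~~ adj c (m x).
  move=> xS; apply/negP=> cmx; move: (xS); rewrite inE => /and3P[cx xa xma].
  by case: (one x (offS x xS) cx cmx) => e; rewrite e eqxx in xa xma.
pose s i : G := enum_val (i : 'I_#|S|).
have sS i : s i \in S by exact: enum_valP.
have sc i : s i != c by exact: offS.
exists #|S|; apply: isomorphic_sym.
pose g (x : subdivided_star_triangle #|S|) : G :=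
  match x with
  | inl (inl None) => c
  | inl (inl (Some i)) => m (s i)
  | inl (inr E) => s (star_edge_leaf E)
  | inr b => if b then a else m a
  end.
have cs i : adj c (s i) by have := sS i; rewrite inE => /andP[].
have ncms i : adj c (m (s i)) = false by apply: negbTE; exact: mSc.
have cab b : adj c (if b then a else m a).
  by case: b; [exact: spider_a sp | exact: spider_ma sp].
have gc x : x != inl (inl None) -> g x != c.
  move: x => [[[i|]|E]|[]] //= _; rewrite ?offm //.
have g_s i b : s i = (if b then a else m a) -> False.
  move=> e; have := sS i; rewrite inE => /and3P[_].
  by rewrite e; case: (b); rewrite eqxx.
have g_ms i y : m (s i) = y -> adj c y -> False by move=> <-; rewrite ncms.
have ama : a != m a by rewrite adj_neq // (spider_adj sp) ?offm.
have injg : injective g.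
  move=> x y; have [->|x0] := eqVneq x (inl (inl None)).
    by have [-> //|/gc/negP nc] := eqVneq y (inl (inl None)) => /esym/eqP.
  have [->|y0] := eqVneq y (inl (inl None)).
    by move/eqP; rewrite (negbTE (gc x x0)).
  move: x y x0 y0 => [[[i|]|E]|b] [[[j|]|F]|d] //= _ _ e.
  - have /enum_val_inj-> // : s i = s j by rewrite -(mK (s i)) // e mK.
  - by case: (g_ms _ _ e).
  - by case: (g_ms _ _ e).
  - by case: (g_ms _ _ (esym e)).
  - by rewrite -(star_edge_leafK E) (enum_val_inj e) star_edge_leafK.
  - by case: (g_s _ _ e).
  - by case: (g_ms _ _ (esym e)).
  - by case: (g_s _ _ (esym e)).
  - by case: b d e => -[] // e; case/eqP: ama.
have g_pair x : x != inl (inl None) -> g (model_pairing x) = m (g x).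
  by move: x => [[[i|]|E]|[]] //= _; rewrite ?star_edgeK ?mK.
have g_center y : adj c (g y) = adj (inl (inl None) : subdivided_star_triangle #|S|) y.
  move: y => [[[i|]|E]|b] /=; rewrite ?ncms ?cs ?cab ?adj_irrefl //.
  by rewrite /adj /= mem_star_edgeE.
exists g; last first.
  have spH := subdivided_star_triangle_spider #|S|.
  move=> x y; have [->|x0] := eqVneq x (inl (inl None)); first exact: g_center.
  have [->|y0] := eqVneq y (inl (inl None)).
    by rewrite adj_sym g_center adj_sym.
  (* Away from the centres, adjacency means being partners on both sides, and [g] commutes with the
     pairings. *)
  rewrite (spider_adj spH) // (spider_adj sp) ?gc //.
  by rewrite -g_pair // inj_eq.
apply: inj_surj_bij => // y.
have inS x : x \in S -> exists i, s i = x.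
  by move=> xS; exists (enum_rank_in xS x); rewrite /s enum_rankK_in.
have [->|yc] := eqVneq y c; first by exists (inl (inl None)).
have [->|ya] := eqVneq y a; first by exists (inr true).
have [->|yma] := eqVneq y (m a); first by exists (inr false).
case/orP: (spider_foot sp yc) => cy.
  have [|i <-] := inS y; first by rewrite inE cy ya.
  by exists (inl (inr (star_edge i))); rewrite /= star_edgeK.
have [|i ei] := inS (m y).
  rewrite inE cy /=; apply/andP; split.
    by apply: contraNneq yma => <-; rewrite mK.
  by apply: contraNneq ya => e; rewrite -(mK y) // e mK.
by exists (inl (inl (Some i))); rewrite /= ei mK.
Qed.

(** * The pentagon *)

Section Pentagon.
Variable G : sgraph.

(** Numbering by [nat] allows literal indices; only the values at 0 to 4 matter. *)
Definition pentagon (v : nat -> G) : Prop :=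
  [/\ uniq [:: v 0; v 1; v 2; v 3; v 4],
      forall x, x \in [:: v 0; v 1; v 2; v 3; v 4] &
      [/\ forall x, adj (v 0) x = (x \in [:: v 1; v 4]),
      forall x, adj (v 1) x = (x \in [:: v 0; v 2]),
      forall x, adj (v 2) x = (x \in [:: v 1; v 3]),
      forall x, adj (v 3) x = (x \in [:: v 2; v 4]) &
      forall x, adj (v 4) x = (x \in [:: v 3; v 0])]].

Lemma uniq5_eq (v : nat -> G) k l :
  uniq [:: v 0; v 1; v 2; v 3; v 4] -> k < 5 -> l < 5 -> (v k == v l) = (k == l).
Proof.
have nthv i : i < 5 -> v i = nth (v 0) [:: v 0; v 1; v 2; v 3; v 4] i.
  by case: i => [|[|[|[|[|]]]]].
by move=> un lk ll; rewrite (nthv k) // (nthv l) // nth_uniq.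
Qed.

Lemma pentagon_isomorphic v : pentagon v -> isomorphic G (cycle_graph 5).
Proof.
case=> un all5 [a0 a1 a2 a3 a4]; apply: isomorphic_sym.
pose g (i : cycle_graph 5) := v (val i).
have injg : injective g.
  by move=> i j /eqP; rewrite uniq5_eq ?ltn_ord // => /eqP/val_inj.
exists g.
  apply: inj_surj_bij => // y; have := all5 y.
  have mem k : k < 5 -> exists x, g x = v k.
    by move=> lk; exists (Ordinal lk).
  by rewrite !inE => /orP[|/orP[|/orP[|/orP[]]]] /eqP->; apply: mem.
have vE k l : k < 5 -> l < 5 -> (v k == v l) = (k == l) by exact: uniq5_eq.
move=> [i Hi] [j Hj]; rewrite /g /=.
case: i Hi => [|[|[|[|[|]]]]] Hi //; rewrite ?a0 ?a1 ?a2 ?a3 ?a4 !inE !vE //;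
by case: j Hj => [|[|[|[|[|]]]]] Hj.
Qed.

Lemma isomorphic_pentagon : isomorphic G (cycle_graph 5) -> exists v, pentagon v.
Proof.
move/isomorphic_sym=> [g bijg mono].
have injg := bij_inj bijg.
pose v k := g (inord k); exists v.
have vE k l : k < 5 -> l < 5 -> (v k == v l) = (k == l).
  move=> lk ll; rewrite (inj_eq injg).
  by have := val_eqE (inord k : 'I_5) (inord l); rewrite /= !inordK.
have all5 x : x \in [:: v 0; v 1; v 2; v 3; v 4].
  have [f fK gK] := bijg; rewrite -(gK x) -(inord_val (f x)).
  by case: (f x) => -[|[|[|[|[|]]]]] //= _; rewrite !inE eqxx ?orbT.
have adjE k l : k < 5 -> l < 5 ->
  adj (v k) (v l) = (k != l) && ((l == k.+1 %% 5) || (k == l.+1 %% 5)).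
  move=> lk ll; transitivity (cycle_adj (inord k : 'I_5) (inord l)); first exact: mono.
  by rewrite /cycle_adj /= -!val_eqE /= !inordK.
split=> //; first by rewrite /= !inE !vE.
by split=> x; have := all5 x; rewrite !inE => /orP[|/orP[|/orP[|/orP[]]]] /eqP->;
  rewrite adjE // !vE.
Qed.

Section PentagonDomination.
Variable v : nat -> G.
Hypothesis pv : pentagon v.

(** Two non-adjacent vertices already dominate the pentagon, so a minimal dominating set containing
    such a pair equals it; any three vertices contain such a pair. *)
Lemma pentagon_Gamma : Gamma G <= 2.
Proof.
have [un all5 [a0 a1 a2 a3 a4]] := pv.
apply/bigmax_leqP=> D /minsetP[domD minD].
have far x y : x \in D -> y \in D -> dominating [set x; y] -> #|D| <= 2.
  move=> xD yD dxy; rewrite -(minD _ dxy) ?cards2; first by case: (x != y).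
  by rewrite subUset !sub1set xD.
have dom x y : (forall z, z \in [:: v 0; v 1; v 2; v 3; v 4] ->
    (z \in [:: x; y]) || adj x z || adj y z) -> dominating [set x; y].
  move=> H; apply/dominatingP=> z; have := H z (all5 z); rewrite !inE.
  case/orP=> [/orP[->|axz]|ayz]; first by left.
  - by right; exists x; rewrite ?inE ?eqxx // adj_sym.
  - by right; exists y; rewrite ?inE ?eqxx ?orbT // adj_sym.
(* As a sum of five indicators, the cardinality can be settled by running through all 32 subsets. *)
have card5 : #|D| = \sum_(x <- [:: v 0; v 1; v 2; v 3; v 4]) (x \in D).
  rewrite -sum1_card big_mkcond /= [RHS]big_uniq //=.
  by apply: eq_big => [x|x _]; rewrite ?all5 //; case: (x \in D).
rewrite card5 !big_cons big_nil.
have d02 : dominating [set v 0; v 2].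
  by apply: dom => z; rewrite a0 a2 !inE => /orP[|/orP[|/orP[|/orP[]]]] ->; rewrite ?orbT.
have d13 : dominating [set v 1; v 3].
  by apply: dom => z; rewrite a1 a3 !inE => /orP[|/orP[|/orP[|/orP[]]]] ->; rewrite ?orbT.
have d24 : dominating [set v 2; v 4].
  by apply: dom => z; rewrite a2 a4 !inE => /orP[|/orP[|/orP[|/orP[]]]] ->; rewrite ?orbT.
have d30 : dominating [set v 3; v 0].
  by apply: dom => z; rewrite a3 a0 !inE => /orP[|/orP[|/orP[|/orP[]]]] ->; rewrite ?orbT.
have d41 : dominating [set v 4; v 1].
  by apply: dom => z; rewrite a4 a1 !inE => /orP[|/orP[|/orP[|/orP[]]]] ->; rewrite ?orbT.
rewrite card5 !big_cons big_nil in far.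
have f02 xD yD := far _ _ xD yD d02; have f13 xD yD := far _ _ xD yD d13.
have f24 xD yD := far _ _ xD yD d24; have f30 xD yD := far _ _ xD yD d30.
have f41 xD yD := far _ _ xD yD d41; move: f02 f13 f24 f30 f41.
case: (v 0 \in D); case: (v 1 \in D); case: (v 2 \in D); case: (v 3 \in D);
  case: (v 4 \in D) => //= h02 h13 h24 h30 h41;
  first [exact: h02 | exact: h13 | exact: h24 | exact: h30 | exact: h41].
Qed.

(** Inside the path from [v 1] to [v 4], the ends can only be paired with [v 2] and [v 3].
    Dominating [v 0] requires one end, and each end forces the other. *)
Lemma pentagon_minimal_paired : minset (@paired_dominating G) [set~ v 0].
Proof.
have [un all5 [a0 a1 a2 a3 a4]] := pv.
have vE k l : k < 5 -> l < 5 -> (v k == v l) = (k == l) by exact: uniq5_eq.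
apply/minsetP; split.
  apply/paired_dominatingP; split.
    apply/dominatingP=> x; rewrite !inE; have [->|] := eqVneq x (v 0); last by left.
    by right; exists (v 1); rewrite ?a0 !inE ?eqxx ?vE.
  exists (fun x => if x == v 1 then v 2 else if x == v 2 then v 1
              else if x == v 3 then v 4 else v 3).
  move=> x; have := all5 x; rewrite !inE.
  by case/orP=> [|/orP[|/orP[|/orP[]]]] /eqP->;
    rewrite ?(a1, a2, a3, a4) !(vE, inE, eqxx).
move=> D /paired_dominatingP[domD [p pD]] sD.
have n0 : v 0 \notin D by apply/negP=> /(subsetP sD); rewrite !inE eqxx.
have p1 : v 1 \in D -> p (v 1) = v 2.
  move=> /pD[pvD]; rewrite a1 !inE => /orP[]/eqP e _ //.
  by rewrite -e pvD in n0.
have p4 : v 4 \in D -> p (v 4) = v 3.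
  move=> /pD[pvD]; rewrite a4 !inE => /orP[]/eqP e _ //.
  by rewrite -e pvD in n0.
have v12 : v 1 \in D -> v 2 \in D by move=> v1; rewrite -p1 //; case: (pD _ v1).
have v43 : v 4 \in D -> v 3 \in D by move=> v4; rewrite -p4 //; case: (pD _ v4).
(* If [v 3] dominates [v 4], its partner is [v 2] or [v 4], and [v 2] is already taken by [v 1]. *)
have v14 : v 1 \in D -> v 4 \in D.
  move=> v1; case: (dominatingP _ domD (v 4)) => // -[y yD].
  rewrite a4 !inE => /orP[]/eqP ey; rewrite ey ?(negbTE n0) // in yD.
  have [pvD] := pD _ yD; rewrite a3 !inE => /orP[]/eqP e pp; last by rewrite -e.
  have [_ _] := pD _ v1; rewrite p1 // -e pp => /eqP; by rewrite vE.
have v41 : v 4 \in D -> v 1 \in D.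
  move=> v4; case: (dominatingP _ domD (v 1)) => // -[y yD].
  rewrite a1 !inE => /orP[]/eqP ey; rewrite ey ?(negbTE n0) // in yD.
  have [pvD] := pD _ yD; rewrite a2 !inE => /orP[]/eqP e pp; first by rewrite -e.
  have [_ _] := pD _ v4; rewrite p4 // -e pp => /eqP; by rewrite vE.
have [v1 v4] : v 1 \in D /\ v 4 \in D.
  case: (dominatingP _ domD (v 0)) => [|[y yD]]; first by rewrite (negbTE n0).
  by rewrite a0 !inE => /orP[]/eqP ey; rewrite ey in yD; split; auto.
apply/eqP; rewrite eqEsubset sD; apply/subsetP=> x; have := all5 x.
by rewrite !inE => /orP[|/orP[|/orP[|/orP[]]]] /eqP->; rewrite ?eqxx // => _; auto.
Qed.

Lemma pentagon_Gamma_pr : Gamma_pr G = 2 * Gamma G.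
Proof.
apply/eqP; rewrite eqn_leq Gamma_pr_leq.
apply: leq_trans (leq_Gamma_pr pentagon_minimal_paired).
rewrite cardsC1 -cardsT.
have [un all5 _] := pv.
have -> : #|[set: G]| = 5.
  rewrite cardsT; have /= <- := card_uniqP un; apply: eq_card => x.
  by rewrite all5.
by rewrite (@leq_mul2l 2 _ 2) pentagon_Gamma.
Qed.

End PentagonDomination.
End Pentagon.

(** * Unicyclic graphs attaining equality *)

Section Forward.
Variable G : sgraph.
Hypotheses (uni : unicyclic G) (eqG : Gamma_pr G = 2 * Gamma G).

Lemma equality_almost_spanning : exists c : G, exists2 m : G -> G,
  minset (@paired_dominating G) [set~ c] & pairing [set~ c] m.
Proof.
have [cyc [uc sc _]] := unicyclic_cycle uni.
have cG : 2 < #|G|.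
  apply: leq_trans sc _; case/andP: uc => _ uc.
  by rewrite -(card_uniqP uc) max_card.
have [|D Dmin cD] := @Gamma_pr_attained G.
  (* More than two vertices and the bound [2 * Gamma G + 1] on their number make [Gamma G]
     positive. *)
  by rewrite eqG; have := leq_trans cG (unicyclic_card uni); case: (Gamma G).
have [pD _] := minsetP Dmin; have [_ [m mD]] := paired_dominatingP _ pD.
have: #|~: D| <= 1.
  by rewrite -(leq_add2l #|D|) cardsC cD eqG addn1 unicyclic_card.
rewrite leq_eqVlt ltnS leqn0 => /orP[/cards1P[c ec]|].
  by exists c, m; rewrite -ec setCK.
rewrite cards_eq0 => /eqP D0.
have DT x : x \in D by rewrite -(setCK D) D0 !inE.
case: cyc uc sc => // x cyc uc sc.
have [|y [z [_ _ yz axy axz]]] := cycle_neighbours uc sc (_ : x \in _).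
  by rewrite mem_head.
(* If [D] were everything, an unmatched edge would yield, by exchange, a vertex outside [D]; hence
   all edges are matched, yet a vertex on the cycle has two neighbours. *)
have matched u : adj x u -> u = m x.
  move=> axu; apply/eqP; apply/negPn/negP=> um.
  by have [w] := minimal_paired_swap Dmin mD (DT x) (DT u) axu um; rewrite DT.
by rewrite (matched y) // (matched z) ?eqxx in yz.
Qed.


Section NearlySpanning.
Variables (c : G) (m : G -> G).
Hypotheses (Dmin : minset (@paired_dominating G) [set~ c]).
Hypothesis (mD : pairing [set~ c] m).

Let in_off x : x != c -> x \in [set~ c].
Proof. by rewrite !inE. Qed.

Let off x : x != c -> m x != c.
Proof. by move/in_off/mD => []; rewrite !inE. Qed.

Let adjm x : x != c -> adj x (m x).
Proof. by move/in_off/mD => []. Qed.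

Let mK x : x != c -> m (m x) = x.
Proof. by move/in_off/mD => []. Qed.

Let m_inj x y : x != c -> y != c -> m x = m y -> x = y.
Proof. by move=> xc yc e; rewrite -(mK xc) e mK. Qed.

Let m_neq x : x != c -> m x != x.
Proof. by move/adjm/adj_neq; rewrite eq_sym. Qed.

(** The vertex left undominated by the exchange lies outside [[set~ c]], so it is [c] itself. *)
Lemma unmatched_edge_center s s' z :
  s != c -> s' != c -> adj s s' -> s' != m s -> adj c z -> z = m s \/ z = m s'.
Proof.
move=> sc s'c ass ne cz.
have [w] := minimal_paired_swap Dmin mD (in_off sc) (in_off s'c) ass ne.
rewrite !inE negbK => /eqP-> H; apply: H => //; rewrite !inE eq_sym.
exact: adj_neq cz.
Qed.

Lemma closed_full (A : {set G}) x :
  x \in A -> (forall u v, adj u v -> u \in A -> v \in A) -> forall y, y \in A.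
Proof.
move=> xA clA y; have [conn _] := uni.
rewrite -(closed_connect _ (conn x y)) // => u v auv.
by apply/idP/idP; apply: clA => //; rewrite adj_sym.
Qed.

(** The only edges off [c] are the pairs, so the cycle is a triangle formed by [c] and a pair; its
    uniqueness excludes a second such pair, and connectivity attaches every pair to [c]. *)
Lemma matched_spider :
  (forall x y, x != c -> y != c -> adj x y -> y = m x) ->
  exists t, isomorphic G (subdivided_star_triangle t).
Proof.
move=> mat; have [cyc [uc sc ucyc]] := unicyclic_cycle uni.
have nbr x y : x != c -> adj x y -> y = m x \/ y = c.
  by move=> xc axy; have [->|yc] := eqVneq y c; [right | left; exact: mat].
(* The two neighbours of [x] along the cycle can only be [m x] and [c]. *)
have on_cyc x : x \in cyc -> x != c -> adj c x /\ m x \in cyc.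
  move=> xC xc; have [y [z [yC zC yz axy axz]]] := cycle_neighbours uc sc xC.
  have [ey|ey] := nbr x y xc axy; have [ez|ez] := nbr x z xc axz.
  - by rewrite ey ez eqxx in yz.
  - by rewrite -ey -ez adj_sym.
  - by rewrite -ey -ez adj_sym.
  - by rewrite ey ez eqxx in yz.
have [a aC ac] : exists2 a, a \in cyc & a != c.
  have [x xC] : exists x, x \in cyc.
    by case: (cyc) sc => // x q _; exists x; rewrite mem_head.
  have [y [z [yC zC yz _ _]]] := cycle_neighbours uc sc xC.
  have [ey|ey] := eqVneq y c; last by exists y.
  by exists z; rewrite // -ey eq_sym.
have [ca maC] := on_cyc a aC ac; have [cma _] := on_cyc _ maC (off ac).
have triangle x : x != c -> adj c x -> adj c (m x) -> ucycle (@adj G) [:: c; x; m x].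
  move=> xc cx cmx; rewrite /ucycle /= cx adjm // [adj _ c]adj_sym cmx !inE.
  by rewrite (negbTE (adj_neq cx)) (negbTE (adj_neq cmx)) eq_sym m_neq.
apply: (@spider_isomorphic G c a m); last first.
  move=> x xc cx cmx.
  have := ucyc _ (triangle x xc cx cmx) isT x.
  rewrite -(ucyc _ (triangle a ac ca cma) isT) !inE eqxx orbT (negbTE xc) /=.
  by move/esym=> /orP[]/eqP; [left | right].
split=> //.
- move=> x y xc yc; apply/idP/eqP => [|->]; [exact: mat | exact: adjm].
(* A pair without a neighbour in [c] would be a connected component missing [c]. *)
- move=> x xc; apply: contraTT isT; rewrite negb_or => /andP[ncx ncmx].
  have := @closed_full [set x; m x] x _ _ c; rewrite !inE eqxx.
  rewrite ![c == _]eq_sym (negbTE xc) (negbTE (off xc)) /=; apply=> // u v auv.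
  have vc w : w != c -> ~~ adj c w -> adj w v -> v = m w.
    by move=> wc ncw awv; case: (nbr w v wc awv) => // e; rewrite -e adj_sym awv in ncw.
  rewrite !inE => /orP[]/eqP eu; rewrite eu in auv.
    by rewrite (vc x) // eqxx orbT.
  by rewrite (vc (m x)) ?off // mK // eqxx.
Qed.

Lemma unmatched_pentagon s s' :
  s != c -> s' != c -> adj s s' -> s' != m s -> adj c (m s) -> adj c (m s') ->
  pentagon (nth c [:: c; m s; s; s'; m s']).
Proof.
move=> sc s'c ass ne cms cms'.
have ss : s != s' by exact: adj_neq ass.
have sms' : s != m s' by apply: contraNneq ne => ->; rewrite mK.
have onC z : adj c z = (z \in [:: m s; m s']).
  apply/idP/idP; last by rewrite !inE => /orP[]/eqP->.
  by move/(unmatched_edge_center sc s'c ass ne)=> [->|->]; rewrite !inE eqxx ?orbT.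
(* Any unmatched edge off [c] confines the neighbours [m s], [m s'] of [c] to the partners of its
   own ends, so it is the edge between [s] and [s']. *)
have unm x y : x != c -> y != c -> adj x y -> y != m x ->
    (x = s /\ y = s') \/ (x = s' /\ y = s).
  move=> xc yc axy nxy; have xy := adj_neq axy.
  have [e|e] := unmatched_edge_center xc yc axy nxy cms;
  have [e'|e'] := unmatched_edge_center xc yc axy nxy cms'.
  - by rewrite (m_inj sc s'c) ?eqxx // e in ss.
  - by left; rewrite (m_inj sc xc e) (m_inj s'c yc e').
  - by right; rewrite (m_inj sc yc e) (m_inj s'c xc e').
  - by rewrite (m_inj sc s'c) ?eqxx // e in ss.
have msms : m s != m s' by apply: contraNneq ss => /m_inj->.
have a1 x : adj (m s) x = (x \in [:: c; s]).
  have [->|xc] := eqVneq x c; first by rewrite adj_sym cms inE eqxx.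
  rewrite !inE (negbTE xc) /=; apply/idP/eqP => [amx|->]; last by rewrite adj_sym adjm.
  apply/eqP; apply: contraTT isT => xs.
  have nms : x != m (m s) by rewrite mK.
  have [[e _]|[e _]] := unm (m s) x (off sc) xc amx nms.
    by have := m_neq sc; rewrite e eqxx.
  by rewrite -e eqxx in ne.
have a4 x : adj (m s') x = (x \in [:: s'; c]).
  have [->|xc] := eqVneq x c; first by rewrite adj_sym cms' !inE eqxx orbT.
  rewrite !inE (negbTE xc) orbF; apply/idP/eqP => [amx|->]; last by rewrite adj_sym adjm.
  apply/eqP; apply: contraTT isT => xs.
  have nms : x != m (m s') by rewrite mK.
  have [[e _]|[e _]] := unm (m s') x (off s'c) xc amx nms.
    by rewrite -e eqxx in sms'.
  by have := m_neq s'c; rewrite e eqxx.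
have a2 x : adj s x = (x \in [:: m s; s']).
  have [->|xc] := eqVneq x c.
    rewrite adj_sym onC !inE (negbTE sms') eq_sym (negbTE (m_neq sc)).
    by rewrite eq_sym (negbTE (off sc)) eq_sym (negbTE s'c).
  rewrite !inE; apply/idP/idP => [asx|/orP[]/eqP->//]; last exact: adjm.
  apply: contraTT isT; rewrite negb_or => /andP[n1 n2].
  have [[_ e]|[e _]] := unm s x sc xc asx n1; first by rewrite e eqxx in n2.
  by rewrite e eqxx in ss.
have a3 x : adj s' x = (x \in [:: s; m s']).
  have [->|xc] := eqVneq x c.
    rewrite adj_sym onC !inE (negbTE ne) eq_sym (negbTE (m_neq s'c)).
    by rewrite eq_sym (negbTE sc) eq_sym (negbTE (off s'c)).
  rewrite !inE; apply/idP/idP => [asx|/orP[]/eqP->]; last 2 first.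
  - by rewrite adj_sym.
  - exact: adjm.
  apply: contraTT isT; rewrite negb_or => /andP[n1 n2].
  have [[e _]|[_ e]] := unm s' x s'c xc asx n2; last by rewrite e eqxx in n1.
  by rewrite -e eqxx in ss.
split; last by split.
  rewrite /= !inE !negb_or ![c == _]eq_sym !off // sc s'c /=.
  rewrite m_neq // msms ss sms' [s' == _]eq_sym m_neq // [m s == s']eq_sym ne.
  by [].
(* The five vertices are closed under adjacency, so by connectivity there are no others. *)
move=> x; suff: x \in [set y in [:: c; m s; s; s'; m s']] by rewrite inE.
apply: (@closed_full _ c); first by rewrite !inE eqxx.
move=> u v auv; rewrite !inE => eu.
case/orP: eu auv => [|/orP[|/orP[|/orP[]]]] /eqP->;
  by rewrite ?(onC, a1, a2, a3, a4) !inE => /orP[]/eqP->; rewrite eqxx ?orbT.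
Qed.

(** A vertex [c] of degree one is contradictory. Every unmatched edge off [c] contains [m a], and
    the cycle avoids [c], so some [x] with [x], [m x], [m a] mutually adjacent exists. A private
    neighbour of the pair of [x] cannot be [c], whose neighbour [a] is outside the pair, nor a
    vertex of the pair, since both see [m a]. *)
Lemma center_leaf_matched a :
  (forall z, adj c z = (z == a)) ->
  forall x y, x != c -> y != c -> adj x y -> y = m x.
Proof.
move=> Nc x0 y0 x0c y0c a0; apply/eqP; apply: contraTT isT => ne0.
have ca : adj c a by rewrite Nc.
have ac : a != c by rewrite eq_sym adj_neq.
have zc := off ac.
have mz x y : x != c -> y != c -> adj x y -> y != m x -> x = m a \/ y = m a.
  move=> xc yc axy nxy; have [->|->] := unmatched_edge_center xc yc axy nxy ca.
    by left; rewrite mK.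
  by right; rewrite mK.
have [cyc [uc sc _]] := unicyclic_cycle uni.
have Cc x : x \in cyc -> x != c.
  move=> xC; apply/eqP=> xc; rewrite xc in xC.
  have [y [z [_ _ yz]]] := cycle_neighbours uc sc xC.
  by rewrite !Nc => /eqP ey /eqP ez; rewrite ey ez eqxx in yz.
have on_cyc x : x \in cyc -> x != m a -> [/\ m x \in cyc, m x != m a & adj x (m a)].
  move=> xC xz; have [y [z [yC zC yz axy axz]]] := cycle_neighbours uc sc xC.
  have nb u : u \in cyc -> adj x u -> u = m x \/ u = m a.
    move=> uC axu; have [->|nu] := eqVneq u (m x); first by left.
    by have [e|] := mz x u (Cc x xC) (Cc u uC) axu nu; [rewrite e eqxx in xz | right].
  have [ey|ey] := nb y yC axy; have [ez|ez] := nb z zC axz.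
  - by rewrite ey ez eqxx in yz.
  - by rewrite -ey -ez.
  - by rewrite -ey -ez eq_sym.
  - by rewrite ey ez eqxx in yz.
have [x xC xz] : exists2 x, x \in cyc & x != m a.
  have [x xC] : exists x, x \in cyc.
    by case: (cyc) sc => // x q _; exists x; rewrite mem_head.
  have [y [z [yC zC yz _ _]]] := cycle_neighbours uc sc xC.
  have [ey|ey] := eqVneq y (m a); last by exists y.
  by exists z; rewrite // -ey eq_sym.
have [mxC mxz axz] := on_cyc x xC xz; have [_ _ amxz] := on_cyc _ mxC mxz.
have xc := Cc x xC.
have [w pw] := minimal_paired_private Dmin mD (in_off xc).
have [ew|wc] := eqVneq w c.
  have [e|e] : a = x \/ a = m x by apply: pw; [exact: in_off | right; rewrite ew].
    by rewrite e eqxx in mxz.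
  by rewrite e mK ?eqxx in xz.
have awz : adj w (m a).
  by have [->|->] : w = x \/ w = m x by apply: pw; [exact: in_off | left].
have [e|e] : m a = x \/ m a = m x by apply: pw; [exact: in_off | right].
  by rewrite e eqxx in xz.
by rewrite e eqxx in mxz.
Qed.

Lemma nearly_spanning_classification :
  isomorphic G (cycle_graph 5) \/
  exists t, isomorphic G (subdivided_star_triangle t).
Proof.
case: (pickP (fun e : G * G => [&& e.1 != c, e.2 != c, adj e.1 e.2 & e.2 != m e.1])).
  move=> [s s'] /= /and4P[sc s'c ass ne].
  have only := @unmatched_edge_center s s' _ sc s'c ass ne.
  have [pD _] := minsetP Dmin; have [domD _] := paired_dominatingP _ pD.
  have [ca|nca] := boolP (adj c (m s)); have [cb|ncb] := boolP (adj c (m s')).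
  - by left; apply: pentagon_isomorphic (unmatched_pentagon sc s'c ass ne ca cb).
  - have Nc z : adj c z = (z == m s).
      by apply/idP/eqP => [cz|-> //]; case: (only z cz) => // e; rewrite -e cz in ncb.
    by case/eqP: ne; apply: (center_leaf_matched Nc).
  - have Nc z : adj c z = (z == m s').
      by apply/idP/eqP => [cz|-> //]; case: (only z cz) => // e; rewrite -e cz in nca.
    by case/eqP: ne; apply: (center_leaf_matched Nc).
  (* Here [c] would have no neighbour at all, but it must be dominated. *)
  - case: (dominatingP _ domD c) => [|[y _ cy]]; first by rewrite !inE eqxx.
    by case: (only y cy) => e; rewrite -e cy in nca ncb.
move=> none; right; apply: matched_spider => x y xc yc axy; apply/eqP.
by have := none (x, y); rewrite /= xc yc axy /= => /negbT; rewrite negbK.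
Qed.

End NearlySpanning.

End Forward.

Theorem theorem11 (G : sgraph) (hG : unicyclic G) :
  Gamma_pr G = 2 * Gamma G <->
  isomorphic G (cycle_graph 3) \/
  isomorphic G (cycle_graph 5) \/
  exists t : nat, isomorphic G (subdivided_star_triangle t).
Proof.
split=> [eqG|].
  have [c [m Dmin mD]] := equality_almost_spanning hG eqG.
  (* The triangle needs no separate case here: it is [subdivided_star_triangle 0]. *)
  by right; exact: nearly_spanning_classification Dmin mD.
case=> [iso3|[/isomorphic_pentagon[v /pentagon_Gamma_pr //]|[t isot]]].
  have [c [a [m sp]]] := triangle_spider.
  by have [c' [a' [m' /spider_Gamma_pr]]] := spider_iso iso3 sp.
by have [c' [a' [m' /spider_Gamma_pr]]] :=
  spider_iso isot (subdivided_star_triangle_spider t).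
Qed.
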